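(* Let $k\ge4$ be even and let $G$ be a simple graph. Then, as a set (regardless of multiplicities), the spectrum of $\mathcal{L}(G^{k,\frac{k}{2}})$ equals the union of the sets of eigenvalues of the matrices $\mathcal{L}^{\mathcal{E}}(G^o[U])=D(G^o[U])-\mathcal{E}A(G[U])\mathcal{E}$, taken over all $U\subseteq V(G)$ with $G^o[U]$ connected and all diagonal matrices $\mathcal{E}=\mathrm{diag}\{e^{\mathrm{i}2\pi\ell_u/k}:u\in U\}$ with $\ell_u\in\{0,1,\dots,k-1\}$. Furthermore, as a set, the $H$-spectrum of $\mathcal{L}(G^{k,\frac{k}{2}})$ equals the union of the sets of eigenvalues of the Laplacian matrices $L(G^o[U])=D(G^o[U])-A(G[U])$ over all $U\subseteq V(G)$ with $G^o[U]$ connected.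
   Context: Tensors: for a real order-$k$, dimension-$n$ tensor $\mathcal{T}$ and $x\in\mathbb{C}^n$, $(\mathcal{T}x^{k-1})_i=\sum_{i_2,\dots,i_k}t_{ii_2\dots i_k}x_{i_2}\cdots x_{i_k}$; $\lambda\in\mathbb{C}$ is an eigenvalue with eigenvector $x\ne0$ if $\mathcal{T}x^{k-1}=\lambda x^{[k-1]}$, $x^{[k-1]}=(x_i^{k-1})_i$; an eigenvalue with a real eigenvector is an $H$-eigenvalue. The spectrum is the set of eigenvalues and the $H$-spectrum the set of $H$-eigenvalues. Hypergraphs: degree $d_v$ = number of edges containing $v$. For a $k$-uniform hypergraph on $v_1,\dots,v_n$, $\mathcal{A}$ has $a_{i_1\dots i_k}=\frac{1}{(k-1)!}$ if $\{v_{i_1},\dots,v_{i_k}\}$ is an edge, else $0$; $\mathcal{D}$ diagonal with $d_{i\dots i}=d_{v_i}$; Laplacian tensor $\mathcal{L}=\mathcal{D}-\mathcal{A}$. Graphs with loops: a loop is a one-vertex edge; $A(\cdot)$ is the adjacency matrix ignoring loops and $D(\cdot)$ the diagonal degree matrix, each loop contributing $1$. For $U\subseteq V(G)$, $G[U]$ is the induced subgraph and the modified induced subgraph $G^o[U]$ is $G[U]$ together with $d_v(G)-d_v(G[U])$ loops at each $v\in U$; it is connected if $G[U]$ is connected. Generalized power $G^{k,\frac{k}{2}}$ ($k\ge4$ even): replace each vertex $v$ of $G$ by a set $\mathbf{v}$ of $\frac{k}{2}$ vertices containing $v$ (pairwise disjoint), and for each edge $\{u,v\}$ of $G$ take $\mathbf{u}\cup\mathbf{v}$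 as an edge. *)

(* Defs.v *)
From HB Require Import structures.
From mathcomp Require Import all_boot all_order all_algebra.
From mathcomp Require Import complex.
From mathcomp Require Import all_classical all_reals all_analysis.

Set Implicit Arguments.
Unset Strict Implicit.
Unset Printing Implicit Defensive.

Import Order.TTheory GRing.Theory Num.Theory.

Local Open Scope complex_scope.
Local Open Scope ring_scope.
Local Open Scope set_scope.

(* Indexed by a finite type [I] instead of 1..n; the dimension is #|I|. *)
Definition tensor (R : Type) (k : nat) (I : Type) := k.-tuple I -> R.

(* (T x^(k-1))_i : the sum ranges over the tuples (i, i_2, ..., i_k). *)
Definition tensor_app (R : realType) (k : nat) (I : finType)
    (T : tensor R k I) (x : I -> R[i]) (i : I) : R[i] :=
  \sum_(s : k.-tuple I | ohead s == Some i)
     (T s)%:C * \prod_(j <- behead s) x j.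

Definition eigenpair (R : realType) (k : nat) (I : finType)
    (T : tensor R k I) (lambda : R[i]) (x : I -> R[i]) : Prop :=
  (exists i, x i != 0) /\
  (forall i, tensor_app T x i = lambda * x i ^+ k.-1).

Definition spectrum (R : realType) (k : nat) (I : finType)
    (T : tensor R k I) : set R[i] :=
  [set lambda | exists x : I -> R[i], eigenpair T lambda x]%classic.

Definition Hspectrum (R : realType) (k : nat) (I : finType)
    (T : tensor R k I) : set R[i] :=
  [set lambda | exists x : I -> R, eigenpair T lambda (fun i => (x i)%:C)]%classic.

(* A hypergraph on the vertex type [V] is given by its edge set. *)
Definition hypergraph (V : finType) := {set {set V}}.

Definition uniform_hypergraph (V : finType) (k : nat)
    (G : hypergraph V) : Prop :=
  forall e, e \in G -> #|e| = k.

Definition simple_graph (V : finType) (G : hypergraph V) : Prop :=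
  uniform_hypergraph 2 G.

Definition vdegree (V : finType) (G : hypergraph V) (v : V) : nat :=
  #|[set e in G | v \in e]|.

Definition adj_tensor (R : realType) (k : nat) (V : finType)
    (G : hypergraph V) : tensor R k V :=
  fun s => if [set v in s] \in G then ((k.-1)`!%:R)^-1 else 0.

Definition diag_tensor (R : realType) (k : nat) (V : finType)
    (d : V -> R) : tensor R k V :=
  fun s => if ohead s is Some v then if constant s then d v else 0 else 0.

Definition laplacian_tensor (R : realType) (k : nat) (V : finType)
    (G : hypergraph V) : tensor R k V :=
  fun s => diag_tensor (fun v => (vdegree G v)%:R) s - adj_tensor R G s.
Arguments laplacian_tensor R k {V} G.

(* The generalized power G^{k,k/2}: the vertex v is replaced by the set
   {v} x 'I_(k/2). *)
Definition blowup (V : finType) (k : nat) (v : V) : {set V * 'I_(k./2)} :=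
  [set p | p.1 == v].

Definition gen_power (V : finType) (k : nat) (G : hypergraph V) :
    hypergraph (V * 'I_(k./2))%type :=
  [set \bigcup_(v in e) blowup k v | e : {set V} in G].

(* [lgraph] is the underlying loopless graph, [loops v] the number of loops
   at v. *)
Record loop_graph (V : finType) := LoopGraph {
  lgraph : hypergraph V;
  loops : V -> nat
}.

Definition ldegree (V : finType) (G : loop_graph V) (v : V) : nat :=
  (vdegree (lgraph G) v + loops G v)%N.

Definition edge_rel (V : finType) (G : hypergraph V) : rel V :=
  fun u v => [set u; v] \in G.

Definition connected_graph (V : finType) (G : hypergraph V) : Prop :=
  (0 < #|V|)%N /\ forall u v : V, connect (edge_rel G) u v.

Definition induced_subgraph (V : finType) (G : hypergraph V) (U : {set V}) :
    hypergraph {v : V | v \in U} :=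
  [set e : {set {v : V | v \in U}} | val @: e \in G].

(* The subtraction does not truncate: degrees do not increase in G[U]. *)
Definition modified_induced (V : finType) (G : hypergraph V) (U : {set V}) :
    loop_graph {v : V | v \in U} :=
  LoopGraph (induced_subgraph G U)
    (fun v => (vdegree G (val v) - vdegree (induced_subgraph G U) v)%N).

Definition lconnected (V : finType) (G : loop_graph V) : Prop :=
  connected_graph (lgraph G).

Definition adj_mx (F : pzRingType) (V : finType) (G : hypergraph V) :
    'M[F]_#|V| :=
  \matrix_(i, j) (edge_rel G (enum_val i) (enum_val j))%:R.

Definition deg_mx (F : pzRingType) (V : finType) (G : loop_graph V) :
    'M[F]_#|V| :=
  diag_mx (\row_i (ldegree G (enum_val i))%:R).

Definition laplacian_mx (F : pzRingType) (V : finType) (G : loop_graph V) :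
    'M[F]_#|V| :=
  deg_mx F G - adj_mx F (lgraph G).

(* e^{i t}, by Euler's formula *)
Definition expi (R : realType) (t : R) : R[i] := cos t +i* sin t.

Definition unity_diag (R : realType) (k : nat) (V : finType)
    (l : V -> 'I_k) : 'M[R[i]]_#|V| :=
  diag_mx (\row_i expi (2 * pi * (l (enum_val i))%:R / k%:R)).

Definition twisted_laplacian (R : realType) (k : nat) (V : finType)
    (G : loop_graph V) (l : V -> 'I_k) : 'M[R[i]]_#|V| :=
  deg_mx R[i] G - unity_diag R l *m adj_mx R[i] (lgraph G) *m unity_diag R l.

Definition mx_spectrum (F : fieldType) (n : nat) (M : 'M[F]_n) : set F :=
  [set a | eigenvalue M a]%classic.

(* Main.v *)
(* Let h = k/2 and let p_v be the product of the h coordinates of x over the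
   blown-up vertex v.  Multiplying the eigenvalue equation at (v, j) by x_(v,j)
   turns it into (d_v - lambda) x_(v,j)^k = p_v * sum_(u ~ v) p_u.  If lambda is
   not a degree, x_(v,j)^k does not depend on j, so p_v = eps_v y_v with
   y_v = x_(v,0)^h and eps_v a k-th root of unity; cancelling y_v gives the
   eigenvalue equation of D - E A E at every vertex of the support of y, and a
   connected component of the support serves as U.  If lambda = d_v, then
   U = {v} works.  Conversely, an eigenvector y of D - E A E is lifted by taking
   h-th roots of y_v and putting eps_v in one coordinate of each fiber.  Over
   the reals p itself plays the role of y with all eps_v = 1, and a real
   eigenvector is the real or imaginary part of a complex one. *)

Require Import Defs.
From HB Require Import structures.
From mathcomp Require Import all_boot all_order all_algebra.
From mathcomp Require Import complex ring lra.
From mathcomp Require Import all_classical all_reals all_analysis.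

Set Implicit Arguments.
Unset Strict Implicit.
Unset Printing Implicit Defensive.
Import Order.TTheory GRing.Theory Num.Theory.
Local Open Scope complex_scope.
Local Open Scope ring_scope.
Local Open Scope classical_set_scope.

(** * Action of the adjacency, diagonal and Laplacian tensors on a vector *)

Lemma sum_tuple_head (A : nmodType) (I : finType) (m : nat) (i : I)
    (F : m.+1.-tuple I -> A) :
  \sum_(s : m.+1.-tuple I | ohead s == Some i) F s =
  \sum_(t : m.-tuple I) F [tuple of i :: t].
Proof.
rewrite (reindex_onto (fun t : m.-tuple I => [tuple of i :: t])
  (fun s => [tuple of behead s])) /=.
  apply: eq_bigl => t; rewrite eqxx /=; apply/eqP/val_inj => //=.
by case/tupleP=> j s /= /eqP [->]; apply/val_inj.
Qed.

Lemma set_of_uniq_tuple (I : finType) (m : nat) (t : m.-tuple I) (A : {set I}) :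
  #|A| = m -> all (mem A) t -> uniq t -> [set v in t] = A.
Proof.
move=> cA /allP At ut; apply/eqP; rewrite eqEcard cA cardsE (card_uniqP ut).
rewrite size_tuple leqnn andbT.
by apply/fintype.subsetP => j; rewrite inE => /At.
Qed.

Lemma card_setD1_succ (I : finType) (m : nat) (i : I) (e : {set I}) :
  i \in e -> #|e| = m.+1 -> #|e :\ i| = m.
Proof. by move=> ie ce; move: (cardsD1 i e); rewrite ie ce => -[]. Qed.

(** By cardinality, a tuple of length [m.+1] can exhaust [e] only if its entries are pairwise
    distinct, so its tail is an ordering of [e :\ i]. *)
Lemma set_of_cons_eq (I : finType) (m : nat) (i : I) (t : m.-tuple I)
    (e : {set I}) : i \in e -> #|e| = m.+1 ->
  ([set v in i :: t] == e) = all (mem (e :\ i)) t && uniq t.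
Proof.
move=> ie ce; have ce' := card_setD1_succ ie ce.
apply/eqP/andP => [E|[ale ut]].
  have uit : uniq (i :: t).
    by apply/card_uniqP; rewrite /= size_tuple -ce -E cardsE.
  split; last by case/andP: uit.
  apply/allP => j jt; rewrite /= in_setD1 -E inE in_cons jt orbT andbT.
  by apply: contraTneq jt => ->; case/andP: uit.
by rewrite -(finset.setD1K ie) -(set_of_uniq_tuple ce' ale ut); apply/setP => j; rewrite !inE.
Qed.

(** An edge [e] through [i] arises from exactly the $(k-1)!$ orderings of [e :\ i], all with the
    same product of coordinates, and this count cancels the weight of the tensor entries. *)
Lemma tensor_app_adj (R : realType) (k : nat) (V : finType) (H : hypergraph V)
    (x : V -> R[i]) (i : V) : (0 < k)%N -> uniform_hypergraph k H ->
  tensor_app (adj_tensor R H : tensor R k V) x i =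
  \sum_(e in H | i \in e) \prod_(j in e :\ i) x j.
Proof.
case: k => // m _ uH.
rewrite /tensor_app sum_tuple_head.
pose S (t : m.-tuple V) := [set v in i :: t]%SET.
transitivity (\sum_(t : m.-tuple V | S t \in H)
    ((m`!%:R)^-1)%:C * \prod_(j <- t) x j).
  rewrite [RHS]big_mkcond; apply: eq_bigr => t _.
  rewrite /adj_tensor -/(S t); case: ifP => //= _.
  by rewrite mul0r.
rewrite (partition_big S (fun e => (e \in H) && (i \in e))) /=; last first.
  by move=> t ->; rewrite !inE eqxx.
apply: eq_bigr => e /andP[eH ie].
have ce := uH e eH.
transitivity (\sum_(t in [set t : m.-tuple V | all (mem (e :\ i)) t & uniq t]%SET)
    ((m`!%:R)^-1)%:C * \prod_(j in e :\ i) x j).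
  apply: eq_big => [t|t /andP[_]].
    rewrite inE /= -(set_of_cons_eq t ie ce) /S.
    by case: eqP => [->|]; rewrite ?eH ?andbF.
  rewrite set_of_cons_eq // => /andP[ale ut].
  congr (_ * _).
  rewrite big_uniq // -(set_of_uniq_tuple _ ale ut).
    by apply: eq_bigl => j; rewrite inE.
  exact: card_setD1_succ.
rewrite sumr_const card_uniq_tuples (card_setD1_succ ie ce) ffactnn.
rewrite -mulrnAl -rmorphMn /= -[_^-1 *+ _]mulr_natr.
by rewrite mulVf ?rmorph1 ?mul1r // pnatr_eq0 -lt0n fact_gt0.
Qed.

Lemma tensor_app_diag (R : realType) (k : nat) (V : finType) (d : V -> R)
    (x : V -> R[i]) (i : V) : (0 < k)%N ->
  tensor_app (diag_tensor d : tensor R k V) x i = (d i)%:C * x i ^+ k.-1.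
Proof.
case: k => // m _; rewrite /tensor_app sum_tuple_head /=.
rewrite (bigD1 [tuple of nseq m i]) //= big_nseq iter_mulr mulr1.
rewrite /diag_tensor /= all_pred1_nseq big1 ?addr0 => [|t tn] //.
case: ifP => [/all_pred1P E|]; last by rewrite mul0r.
by case/eqP: tn; apply/val_inj; rewrite /= E size_tuple.
Qed.

Lemma tensor_app_laplacian (R : realType) (k : nat) (V : finType)
    (H : hypergraph V) (x : V -> R[i]) (i : V) :
  (0 < k)%N -> uniform_hypergraph k H ->
  tensor_app (laplacian_tensor R k H) x i =
  (vdegree H i)%:R * x i ^+ k.-1 -
  \sum_(e in H | i \in e) \prod_(j in e :\ i) x j.
Proof.
move=> k0 uH; rewrite -(tensor_app_adj x i k0 uH).
rewrite -(rmorph_nat (real_complex R)) /=.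
rewrite -(tensor_app_diag (fun v => (vdegree H v)%:R) x i k0).
rewrite /tensor_app -sumrB; apply: eq_bigr => s _.
by rewrite -mulrBl /laplacian_tensor rmorphB.
Qed.

(** * Edges, degrees and edge products in the generalized power *)

Definition blowup_set (V : finType) (k : nat) (e : {set V}) :
    {set V * 'I_(k./2)} := \bigcup_(v in e) blowup k v.

Lemma in_blowup_set (V : finType) (k : nat) (e : {set V}) p :
  (p \in blowup_set k e) = (p.1 \in e).
Proof.
apply/bigcupP/idP => [[v ve]|pe]; first by rewrite inE => /eqP ->.
by exists p.1; rewrite // inE.
Qed.

Lemma blowup_set_inj (V : finType) (k : nat) (j : 'I_(k./2)) :
  injective (@blowup_set V k).
Proof.
move=> e f E; apply/setP => v.
by have := in_blowup_set e (v, j); rewrite E in_blowup_set.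
Qed.

Lemma card_blowup_set (V : finType) (k : nat) (e : {set V}) :
  #|blowup_set k e| = (#|e| * k./2)%N.
Proof.
have -> : blowup_set k e = finset.setX e [set: 'I_(k./2)].
  by apply/setP => -[v j]; rewrite in_blowup_set !inE andbT.
by rewrite cardsX cardsT card_ord.
Qed.

Lemma uniform_gen_power (V : finType) (k : nat) (G : hypergraph V) :
  ~~ odd k -> simple_graph G -> uniform_hypergraph k (gen_power k G).
Proof.
move=> ok sG E /imsetP[e eG ->]; rewrite -/(blowup_set k e) card_blowup_set.
by rewrite (sG e eG) mul2n -[RHS]odd_double_half (negbTE ok).
Qed.

Lemma sum_gen_power (A : nmodType) (V : finType) (k : nat) (G : hypergraph V)
    (p : V * 'I_(k./2)) (F : {set V * 'I_(k./2)} -> A) :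
  \sum_(E in gen_power k G | p \in E) F E =
  \sum_(e in G | p.1 \in e) F (blowup_set k e).
Proof.
rewrite [LHS]big_mkcondr [RHS]big_mkcondr /gen_power big_imset /=.
  by apply: eq_bigr => e _; rewrite in_blowup_set.
by move=> e f _ _; apply: (blowup_set_inj p.2).
Qed.

Lemma vdegreeE (V : finType) (G : hypergraph V) (v : V) :
  vdegree G v = (\sum_(e in G | v \in e) 1)%N.
Proof. by rewrite sum1_card /vdegree cardsE. Qed.

Lemma vdegree_gen_power (V : finType) (k : nat) (G : hypergraph V)
    (p : V * 'I_(k./2)) : vdegree (gen_power k G) p = vdegree G p.1.
Proof. by rewrite !vdegreeE sum_gen_power. Qed.

Lemma edge_rel_neq (V : finType) (G : hypergraph V) (u v : V) :
  simple_graph G -> edge_rel G u v -> u != v.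
Proof. by move=> sG /sG; rewrite cards2; case: eqP. Qed.

Lemma edge_rel_sym (V : finType) (G : hypergraph V) : symmetric (edge_rel G).
Proof. by move=> u v; rewrite /edge_rel finset.setUC. Qed.

Lemma sum_edges (A : nmodType) (V : finType) (G : hypergraph V) (v : V)
    (F : {set V} -> A) : simple_graph G ->
  \sum_(e in G | v \in e) F e = \sum_(u | edge_rel G v u) F [set v; u]%SET.
Proof.
move=> sG.
rewrite -(big_imset F (h := fun u => [set v; u]%SET) (A := edge_rel G v)) /=.
  apply: eq_bigl => e; apply/andP/imsetP => [[eG ve]|[u vu ->]]; last first.
    by rewrite !inE eqxx.
  have /eqP/cards1P[u eu] : #|e :\ v| = 1%N by apply: card_setD1_succ => //; apply: sG.
  have E : e = [set v; u]%SET by rewrite -(finset.setD1K ve) eu.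
  by exists u => //; rewrite -topredE /= /edge_rel -E.
move=> u w vu vw /setP /(_ u); rewrite !inE eqxx orbT => /esym/orP[]/eqP // E.
by have := edge_rel_neq sG vu; rewrite E eqxx.
Qed.

Definition fiber_prod (R : comPzRingType) (V : finType) (k : nat)
  (x : V * 'I_(k./2) -> R) (v : V) : R := \prod_j x (v, j).

Lemma prod_blowup_set (R : comPzRingType) (V : finType) (k : nat)
    (x : V * 'I_(k./2) -> R) (e : {set V}) :
  \prod_(p in blowup_set k e) x p = \prod_(v in e) fiber_prod x v.
Proof.
rewrite /fiber_prod pair_big /=.
by apply: eq_big => [p|[v j] _] //; rewrite in_blowup_set andbT.
Qed.

(** * The eigenvalue equation of the generalized power in terms of fiber products *)

Section LaplacianGenPower.
Variables (R : realType) (k : nat) (V : finType) (G : hypergraph V).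
Hypotheses (hk : (4 <= k)%N) (hk_even : ~~ odd k) (hG : simple_graph G).
Variable x : V * 'I_(k./2) -> R[i].

(** The factor [x p] completes each product over an edge minus [p] to a product over the whole edge,
    which splits into the fiber products of its two end vertices. *)
Lemma laplacian_gen_power_mul p :
  tensor_app (laplacian_tensor R k (gen_power k G)) x p * x p =
  (vdegree G p.1)%:R * x p ^+ k -
  fiber_prod x p.1 * \sum_(u | edge_rel G p.1 u) fiber_prod x u.
Proof.
have k0 : (0 < k)%N by apply: leq_trans hk.
rewrite tensor_app_laplacian //; last exact: uniform_gen_power.
rewrite vdegree_gen_power mulrBl -mulrA -exprSr prednK //; congr (_ - _).
rewrite sum_gen_power sum_edges // mulr_suml mulr_sumr; apply: eq_bigr => u vu.
rewrite mulrC -big_setD1 /=; last by rewrite in_blowup_set !inE eqxx.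
rewrite prod_blowup_set big_setU1 ?inE ?(edge_rel_neq hG vu) //=.
by rewrite big_set1.
Qed.

(** Multiplication by [x p] loses the equation where [x p] is zero. On a vanishing fiber the
    equation holds anyway: since $k/2\ge2$, every edge through [p] contains another vertex of the
    same fiber, so its product vanishes. *)
Lemma laplacian_gen_power0 p : (forall j, x (p.1, j) = 0) ->
  tensor_app (laplacian_tensor R k (gen_power k G)) x p = 0.
Proof.
case: p => v j /= x0.
rewrite tensor_app_laplacian //; last exact: uniform_gen_power; last first.
  by apply: leq_trans hk.
rewrite x0 expr0n.
have -> : (k.-1 == 0)%N = false by case: k hk => [|[|[|]]].
rewrite mulr0 big1 ?subr0 // => E /andP[/imsetP[e _ ->]].
rewrite -/(blowup_set k e) in_blowup_set /= => ve.
have [j' jj'] : exists j' : 'I_(k./2), j' != j.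
  have h2 : (1 < k./2)%N by rewrite (half_leq hk).
  have [j0|j0] := eqVneq (j : nat) 0%N.
    by exists (Ordinal h2); rewrite -val_eqE /= j0.
  by exists (Ordinal (ltnW h2)); rewrite -val_eqE /= eq_sym.
rewrite (bigD1 (v, j')) /= ?x0 ?mul0r // !inE in_blowup_set /= ve andbT.
by rewrite xpair_eqE eqxx.
Qed.

Lemma gen_power_eigenpair_mul lambda :
  eigenpair (laplacian_tensor R k (gen_power k G)) lambda x ->
  forall p, ((vdegree G p.1)%:R - lambda) * x p ^+ k =
    fiber_prod x p.1 * \sum_(u | edge_rel G p.1 u) fiber_prod x u.
Proof.
move=> [_ ev] p; have := laplacian_gen_power_mul p; rewrite ev -mulrA -exprSr.
rewrite prednK; last by apply: leq_trans hk.
by move=> E; rewrite mulrBl E subKr.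
Qed.

(** On each fiber the coordinates either all vanish, which [laplacian_gen_power0] handles, or are
    all nonzero, so that the factor [x p] can be cancelled. *)
Lemma gen_power_eigenpairP lambda :
  (exists p, x p != 0) ->
  (forall v, (forall j, x (v, j) = 0) \/
    forall j, x (v, j) != 0 /\ ((vdegree G v)%:R - lambda) * x (v, j) ^+ k =
      fiber_prod x v * \sum_(u | edge_rel G v u) fiber_prod x u) ->
  eigenpair (laplacian_tensor R k (gen_power k G)) lambda x.
Proof.
move=> nz H; split => // -[v j].
have [x0|/(_ j)[xn E]] := H v.
  rewrite laplacian_gen_power0 // x0 expr0n.
  by have -> : (k.-1 == 0)%N = false; [case: k hk => [|[|[|]]]|rewrite mulr0].
apply: (mulIf xn); rewrite laplacian_gen_power_mul /= -E -mulrA -exprSr.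
rewrite prednK; last by apply: leq_trans hk.
by rewrite mulrBl subKr.
Qed.
End LaplacianGenPower.

(** * Eigenvectors of the twisted Laplacian of modified induced subgraphs *)

Definition phase (R : realType) (k : nat) (l : 'I_k) : R[i] :=
  expi (2 * pi * l%:R / k%:R).

(** [eigenvalue] speaks of row vectors; as $D-\mathcal{E}A\mathcal{E}$ is symmetric, this is the
    usual column equation, here written for functions on [V]. *)
Lemma eigenvalue_twistedP (R : realType) (k : nat) (V : finType)
    (H : loop_graph V) (l : V -> 'I_k) (lambda : R[i]) :
  eigenvalue (twisted_laplacian R H l) lambda <->
  exists y : V -> R[i], (exists v, y v != 0) /\
    forall v, ((ldegree H v)%:R - lambda) * y v =
      phase R (l v) * \sum_(u | edge_rel (lgraph H) v u) phase R (l u) * y u.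
Proof.
have mulE (Y : 'rV[R[i]]_#|V|) j : (Y *m twisted_laplacian R H l) 0 j =
    (ldegree H (enum_val j))%:R * Y 0 j - phase R (l (enum_val j)) *
    \sum_(u | edge_rel (lgraph H) (enum_val j) u)
      phase R (l u) * Y 0 (enum_rank u).
  rewrite /twisted_laplacian /deg_mx /unity_diag mulmxBr !mulmxA !mul_mx_diag.
  rewrite !mxE; congr (_ - _); rewrite mulrC //; congr (_ * _).
  rewrite [RHS]big_mkcond [RHS](big_enum_val (A := V)) /=; apply: eq_bigr => i _.
  rewrite !mxE enum_valK edge_rel_sym -/(phase R _).
  by case: ifP; rewrite ?mulr1 ?mulr0 // mulrC.
split=> [/eigenvalueP[Y E Yn]|[y [[v yv] E]]].
  exists (fun v => Y 0 (enum_rank v)); split.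
    have [i Yi] : exists i, Y 0 i != 0 by apply/rV0Pn.
    by exists (enum_val i); rewrite enum_valK.
  move=> v; have := mulE Y (enum_rank v).
  by rewrite E mxE enum_rankK mulrBl => ->; rewrite subKr.
apply/eigenvalueP; exists (\row_i y (enum_val i)).
  apply/rowP => j; rewrite mulE !mxE.
  under eq_bigr do rewrite mxE enum_rankK.
  by rewrite -E mulrBl subKr.
by apply/rV0Pn; exists (enum_rank v); rewrite mxE enum_rankK.
Qed.

Section Induced.
Variables (V : finType) (G : hypergraph V) (U : {set V}).
Implicit Types s t : {v : V | v \in U}.

Lemma edge_rel_induced s t :
  edge_rel (induced_subgraph G U) s t = edge_rel G (val s) (val t).
Proof. by rewrite /edge_rel inE imsetU !imset_set1. Qed.

Lemma vdegree_induced s : (vdegree (induced_subgraph G U) s <= vdegree G (val s))%N.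
Proof.
rewrite /vdegree -(card_imset _ (imset_inj val_inj)); apply: subset_leq_card.
apply/fintype.subsetP => e /imsetP[f]; rewrite !inE => /andP[fG sf] ->.
by rewrite fG imset_f.
Qed.

(** The loops exactly restore the degree in [G], so the diagonal term of the equation does not
    depend on [U]. *)
Lemma ldegree_modified s : ldegree (modified_induced G U) s = vdegree G (val s).
Proof. by rewrite /ldegree /= subnKC // vdegree_induced. Qed.

Lemma sum_induced (A : nmodType) s (F : V -> A) :
  \sum_(t | edge_rel (induced_subgraph G U) s t) F (val t) =
  \sum_(u in U | edge_rel G (val s) u) F u.
Proof.
rewrite (big_sub_cond U (edge_rel G (val s)) F).
by apply: eq_bigl => t; rewrite edge_rel_induced.
Qed.
End Induced.

(* With [eps] the diagonal of E, this is the eigenvalue equation of D - E A E,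
   imposed only on the support of [y]. *)
Definition support_eigenvector (F : fieldType) (V : finType) (G : hypergraph V)
    (eps : V -> F) (lambda : F) (y : V -> F) : Prop :=
  (exists v, y v != 0) /\ forall v, y v != 0 ->
    ((vdegree G v)%:R - lambda) * y v =
    eps v * \sum_(u | edge_rel G v u) eps u * y u.

Lemma support_eigenvector_modified (R : realType) (k : nat) (V : finType)
    (G : hypergraph V) (l : V -> 'I_k) (lambda : R[i]) (y : V -> R[i]) :
  support_eigenvector G (fun v => phase R (l v)) lambda y ->
  exists2 U : {set V}, lconnected (modified_induced G U) &
    eigenvalue (twisted_laplacian R (modified_induced G U) (fun s => l (val s)))
      lambda.
Proof.
move=> [[v0 yv0] E].
(* Only the target of a step is tested; as [y v0] is nonzero, everything reachable from [v0] lies in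
   the support, and [U] is the component of [v0] there. *)
pose r u v := edge_rel G u v && (y v != 0).
pose U := [set v | connect r v0 v]%SET.
have U0 : v0 \in U by rewrite inE connect0.
have Uy v : v \in U -> y v != 0.
  rewrite inE => /connectP[p]; elim/last_ind: p v => [|p u _] v /=; first by move=> _ ->.
  by rewrite rcons_path last_rcons => /andP[_ /andP[_ yu]] ->.
exists U; last first.
  apply/eigenvalue_twistedP; exists (fun s => y (val s)); split.
    by exists (exist _ v0 U0).
  move=> s; rewrite ldegree_modified E; last exact: Uy (valP s).
  rewrite (sum_induced G s (fun v => phase R (l v) * y v)); congr (_ * _).
  rewrite [RHS]big_mkcondl; apply: eq_bigr => u su.
  (* A neighbour of [s] outside [U] has [y u = 0], as it would otherwise be reachable from [v0]; so
     restricting the sum to [U] changes nothing. *)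
  case: ifPn => // uU; have [->|yu] := eqVneq (y u) 0; first by rewrite mulr0.
  case/negP: uU; have := valP s; rewrite /= !inE => su'.
  by apply: (connect_trans su'); apply: connect1; rewrite /r su.
pose e := edge_rel (induced_subgraph G U).
have esym : connect_sym e by apply: sym_connect_sym => s t; exact: edge_rel_sym.
(* Each prefix of an [r]-path from [v0] ends in [U], so the path stays in the induced subgraph. *)
have conn0 v (vU : v \in U) : connect e (exist _ v0 U0) (exist _ v vU).
  have := vU; rewrite inE => /connectP[p]; elim/last_ind: p v vU => [|p u IH] v vU /=.
    by move=> _ E0; rewrite (_ : exist _ v vU = exist _ v0 U0) //; apply: val_inj.
  rewrite rcons_path last_rcons => /andP[pp ru] vE.
  have wU : last v0 p \in U by rewrite inE; apply/connectP; exists p.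
  apply: (connect_trans (IH _ wU pp erefl)); apply: connect1.
  by rewrite /e edge_rel_induced /= vE; case/andP: ru.
split; first by apply/card_gt0P; exists (exist _ v0 U0).
move=> [u uU] [v vU]; apply: (connect_trans _ (conn0 v vU)).
by rewrite esym; exact: conn0.
Qed.

Lemma support_eigenvector_of_modified (R : realType) (k : nat) (V : finType)
    (G : hypergraph V) (U : {set V}) (l : V -> 'I_k) (lambda : R[i]) :
  eigenvalue (twisted_laplacian R (modified_induced G U) (fun s => l (val s)))
    lambda ->
  exists y, support_eigenvector G (fun v => phase R (l v)) lambda y.
Proof.
move=> /eigenvalue_twistedP[y [[s0 ys0] E]].
(* Extension by zero: the support stays inside [U], where the equation is known, and nothing is
   asked at the other vertices. *)
pose y' v := if insub v is Some s then y s else 0.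
have y'E s : y' (val s) = y s by rewrite /y' valK.
have y'0 v : v \notin U -> y' v = 0 by move=> vU; rewrite /y' insubN.
exists y'; split; first by exists (val s0); rewrite y'E.
move=> v yv; have vU : v \in U by apply: contraNT yv => /y'0 ->.
have := E (exist _ v vU); rewrite ldegree_modified -y'E /= => ->; congr (_ * _).
under eq_bigr do rewrite -y'E.
rewrite (sum_induced G (exist _ v vU) (fun u => phase R (l u) * y' u)) /=.
rewrite [LHS]big_mkcondl; apply: eq_bigr => u _.
by case: ifPn => // /y'0 ->; rewrite mulr0.
Qed.

(** * Phases as the k-th roots of unity *)

Lemma expiD (R : realType) (s t : R) : expi (s + t) = expi s * expi t.
Proof.
rewrite /expi sinD cosD; congr Complex.
exact: addrC.
Qed.

Lemma expi0 (R : realType) : expi 0 = 1 :> R[i].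
Proof. by rewrite /expi sin0 cos0. Qed.

Lemma expiMn (R : realType) (t : R) n : expi (t *+ n) = expi t ^+ n.
Proof. by elim: n => [|n IH]; rewrite ?expi0 // mulrS expiD IH exprS. Qed.

(** If $\cos t=1$, then $\cos t=1-2\sin^2(t/2)$ forces $\sin(t/2)=0$, whereas $0<t/2<\pi$ makes this
    sine positive. *)
Lemma expi_eq1 (R : realType) (t : R) : 0 < t < 2 * pi -> expi t != 1.
Proof.
move=> /andP[t0 t2]; apply/eqP => -[ct _].
have tE : t = (t / 2) *+ 2 by rewrite -(mulr_natr (t / 2)) divfK.
have s0 : 0 < sin (t / 2).
  by rewrite sin_gt0_pi // divr_gt0 //= ltr_pdivrMr // mulrC.
move: ct; rewrite tE cos_mulr2n cos2sin2 => ct.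
suff /eqP : sin (t / 2) ^+ 2 = 0 by rewrite sqrf_eq0 (gt_eqF s0).
lra.
Qed.

Lemma phaseE (R : realType) (k : nat) (l : 'I_k) :
  phase R l = expi (2 * pi / k%:R) ^+ l.
Proof. by rewrite -expiMn /phase -(mulr_natr (2 * pi / k%:R) l) mulrAC. Qed.

Lemma expi_primitive (R : realType) (k : nat) : (0 < k)%N ->
  k.-primitive_root (expi (2 * pi / k%:R) : R[i]).
Proof.
move=> k0; rewrite /primitive_root_of_unity k0 /=; apply/forallP => i.
have kn0 : k%:R != 0 :> R by rewrite pnatr_eq0 -lt0n.
rewrite unity_rootE -expiMn; apply/eqP; have [->|ik] := eqVneq i.+1 k.
  rewrite -(mulr_natr (2 * pi / k%:R)) divfK // mulrC mulr_natr /expi cos2pi sin2pi.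
  by rewrite eqxx.
apply/negbTE/expi_eq1; rewrite pmulrn_lgt0 //.
rewrite divr_gt0 ?mulr_gt0 ?pi_gt0 ?ltr0n //=.
rewrite -(mulr_natr (2 * pi / k%:R)) -mulrA gtr_pMr ?mulr_gt0 ?pi_gt0 //.
by rewrite mulrC ltr_pdivrMr ?ltr0n // mul1r ltr_nat ltn_neqAle ik ltn_ord.
Qed.

Lemma phase_expr (R : realType) (k : nat) (l : 'I_k) : phase R l ^+ k = 1.
Proof.
have k0 : (0 < k)%N by apply: leq_ltn_trans (ltn_ord l).
by rewrite phaseE exprAC (prim_expr_order (expi_primitive R k0)) expr1n.
Qed.

Lemma phase0 (R : realType) (k : nat) (k0 : (0 < k)%N) :
  phase R (Ordinal k0) = 1.
Proof. by rewrite phaseE expr0. Qed.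

Lemma phase_surj (R : realType) (k : nat) (z : R[i]) : (0 < k)%N ->
  z ^+ k = 1 -> exists l : 'I_k, z = phase R l.
Proof.
move=> k0 /(prim_rootP (expi_primitive R k0))[l ->].
by exists l; rewrite phaseE.
Qed.

(** Taking all phases equal to 1 lets the results on twisted Laplacians also serve the
    $H$-spectrum. *)
Lemma twisted_laplacian0 (R : realType) (k : nat) (k0 : (0 < k)%N)
    (V : finType) (H : loop_graph V) :
  twisted_laplacian R H (fun=> Ordinal k0) = laplacian_mx R[i] H.
Proof.
rewrite /twisted_laplacian (_ : unity_diag R _ = 1%:M) ?mul1mx ?mulmx1 //.
rewrite /unity_diag; apply/matrixP => i j; rewrite !mxE -/(phase R _).
by rewrite phase0.
Qed.

(** * Degrees as eigenvalues, and passage to real vectors *)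

Lemma support_eigenvector_degree (F : fieldType) (V : finType)
    (G : hypergraph V) (eps : V -> F) (v : V) : simple_graph G ->
  support_eigenvector G eps (vdegree G v)%:R (fun u => (u == v)%:R).
Proof.
move=> hG; split; first by exists v; rewrite eqxx oner_neq0.
move=> w; have [-> _|_] := eqVneq w v; last by rewrite eqxx.
(* At [v] both sides vanish: the eigenvalue is the degree of [v], and [v] is not its own
   neighbour. *)
rewrite subrr mul0r big1 ?mulr0 // => u vu.
by rewrite eq_sym (negbTE (edge_rel_neq hG vu)) mulr0.
Qed.

(** A Rayleigh quotient argument: $N=\sum_v|y_v|^2$ is positive and $Q=y^*Ay$ is real by symmetry of
    adjacency, so $Q=\sum_v d_v|y_v|^2-\lambda N$ makes [lambda] real. The equation then passes to
    real and imaginary parts. *)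
Lemma support_eigenvector_real (R : realType) (V : finType) (G : hypergraph V)
    (lambda : R[i]) (y : V -> R[i]) :
  support_eigenvector G (fun=> 1) lambda y ->
  exists z : V -> R, support_eigenvector G (fun=> 1) lambda (fun v => (z v)%:C).
Proof.
move=> [[v0 yv0] E].
pose N := \sum_v y v * (y v)^*%R.
pose Q := \sum_v (y v)^*%R * \sum_(u | edge_rel G v u) y u.
have NE : N = \sum_v `|y v| ^+ 2 by apply: eq_bigr => v _; rewrite normCK.
have QE : Q = (\sum_v (vdegree G v)%:R * (y v * (y v)^*%R)) - lambda * N.
  rewrite /N mulr_sumr -sumrB; apply: eq_bigr => v _.
  (* Off the support the equation may fail, but there the factor $\overline{y_v}$ kills both
     sides. *)
  have [->|yv] := eqVneq (y v) 0; first by rewrite rmorph0 !(mul0r, mulr0) subrr.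
  have := E v yv; rewrite mul1r; under eq_bigr do rewrite mul1r.
  by move=> <-; ring.
have Qr : Q^*%R = Q.
  rewrite /Q rmorph_sum /=.
  under eq_bigr do rewrite rmorphM /= conjCK rmorph_sum /= mulr_sumr.
  under [RHS]eq_bigr do rewrite mulr_sumr.
  rewrite (exchange_big_dep predT) //=; apply: eq_bigr => v _.
  by apply: eq_big => u; rewrite 1?edge_rel_sym // mulrC.
have N0 : N != 0.
  apply: lt0r_neq0; rewrite NE (bigD1 v0) //=.
  rewrite ltr_wpDr ?exprn_gt0 ?normr_gt0 // sumr_ge0 // => v _; exact: exprn_ge0.
have Nr : N^*%R = N.
  by rewrite NE rmorph_sum; apply: eq_bigr => v _; rewrite rmorphXn /= conj_normC.
have lr : lambda \is Num.real.
  apply/CrealP; apply: (mulIf N0); rewrite -{1}Nr -rmorphM.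
  have -> : lambda * N = (\sum_v (vdegree G v)%:R * (y v * (y v)^*%R)) - Q.
    by rewrite QE subKr.
  rewrite rmorphB /= Qr rmorph_sum; congr (_ - _); apply: eq_bigr => v _.
  by rewrite !rmorphM /= conjCK rmorph_nat [_^*%R * _]mulrC.
(* Here [f] stands for the real or the imaginary part: it commutes with the real scalar
   $d_v-\lambda$, and the support of [f (y v)] lies in that of [y]. *)
have sol (f : {additive R[i] -> R[i]}) (z : V -> R) :
    (forall a, a \is Num.real -> forall w, f (a * w) = a * f w) ->
    (forall v, (z v)%:C = f (y v)) -> f (y v0) != 0 ->
    support_eigenvector G (fun=> 1) lambda (fun v => (z v)%:C).
  move=> fM zE fy; split; first by exists v0; rewrite zE.
  move=> v; rewrite zE => fv.
  have yv : y v != 0 by apply: contraNneq fv => ->; rewrite raddf0.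
  rewrite -fM ?rpredB ?realn // E // !mul1r raddf_sum.
  by apply: eq_bigr => u _; rewrite !mul1r zE.
have [re0|re0] := eqVneq ('Re (y v0)) 0; last first.
  exists (fun v => complex.Re (y v)).
  by apply: (sol [the {additive _ -> _} of (@Re _)]) => // [a ar w|v];
    [exact: ReMl|exact: complexRe].
exists (fun v => complex.Im (y v)).
apply: (sol [the {additive _ -> _} of (@Im _)]) => // [a ar w|v|].
- exact: ImMl.
- exact: complexIm.
by apply: contraNneq yv0 => im0; rewrite [y v0]Crect re0 im0 mulr0 addr0.
Qed.

(** * The spectrum and the H-spectrum through support eigenvectors *)

Section SpectraGenPower.
Variables (R : realType) (k : nat) (V : finType) (G : hypergraph V).
Hypotheses (hk : (4 <= k)%N) (hk_even : ~~ odd k) (hG : simple_graph G).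
Local Notation L := (laplacian_tensor R k (gen_power k G)).

Lemma exprn_half2 (A : pzSemiRingType) (a : A) : (a ^+ k./2) ^+ 2 = a ^+ k.
Proof. by rewrite -exprM muln2 -[in RHS](odd_double_half k) (negbTE hk_even). Qed.

Lemma exprn2_half (A : pzSemiRingType) (a : A) : (a ^+ 2) ^+ k./2 = a ^+ k.
Proof. by rewrite exprAC exprn_half2. Qed.

(** The relation $x_{(v,j)}^k=y_v^2$ makes each fiber vanish entirely or nowhere; on the support,
    the equation for [y] multiplied by [y v] is the one for [x]. Keeping [eps] and [y] abstract
    covers both the complex and the real lift. *)
Lemma gen_power_eigenpair_of_support (eps y : V -> R[i]) lambda
    (x : V * 'I_(k./2) -> R[i]) :
  support_eigenvector G eps lambda y ->
  (forall v j, x (v, j) ^+ k = y v ^+ 2) ->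
  (forall v, fiber_prod x v = eps v * y v) -> eigenpair L lambda x.
Proof.
move=> [[v0 yv0] E] xk px.
have k0 : (0 < k)%N by apply: leq_trans hk.
have h0 : (0 < k./2)%N by rewrite half_gt0; apply: leq_trans hk.
have xn v j : (x (v, j) == 0) = (y v == 0).
  by have := congr1 (fun z => z == 0) (xk v j); rewrite !expf_eq0 k0.
apply: gen_power_eigenpairP => //; first by exists (v0, Ordinal h0); rewrite xn.
move=> v; have [yv|yv] := eqVneq (y v) 0.
  by left => j; apply/eqP; rewrite xn yv.
right => j; rewrite xn yv xk px expr2 mulrA E // -mulrA [RHS]mulrAC -mulrA.
by under [in RHS]eq_bigr do rewrite px.
Qed.

(** The right side of the multiplied equation depends only on the vertex [v], and $d_v-\lambda$ can
    be cancelled. *)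
Lemma gen_power_fiber_const lambda x :
  eigenpair L lambda x -> (forall v, (vdegree G v)%:R != lambda) ->
  forall v i j, x (v, i) ^+ k = x (v, j) ^+ k.
Proof.
move=> ex nd v i j; have vd : (vdegree G v)%:R - lambda != 0 by rewrite subr_eq0.
by apply: (mulfI vd); rewrite !(gen_power_eigenpair_mul _ _ _ ex (_, _)).
Qed.

Lemma gen_power_support_of_eigenpair (eps y : V -> R[i]) lambda x :
  eigenpair L lambda x -> (forall v, (vdegree G v)%:R != lambda) ->
  (forall v j, y v ^+ 2 = x (v, j) ^+ k) ->
  (forall v, fiber_prod x v = eps v * y v) ->
  support_eigenvector G eps lambda y.
Proof.
move=> ex nd y2 px; split.
  have [[[v j] xv] _] := ex; exists v; move: xv; apply: contraNneq => yv.
  have := y2 v j; rewrite yv expr0n => /esym/eqP; rewrite expf_eq0.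
  by case/andP.
move=> v yv; apply: (mulIf yv).
have h0 : (0 < k./2)%N by rewrite half_gt0; apply: leq_trans hk.
have := gen_power_eigenpair_mul hk hk_even hG ex (v, Ordinal h0).
rewrite -y2 /= expr2 mulrA => ->; rewrite px mulrAC.
by under eq_bigr do rewrite px.
Qed.

Lemma spectrum_gen_powerP lambda : spectrum L lambda <->
  exists (l : V -> 'I_k) (y : V -> R[i]),
    support_eigenvector G (fun v => phase R (l v)) lambda y.
Proof.
have k0 : (0 < k)%N by apply: leq_trans hk.
have h0 : (0 < k./2)%N by rewrite half_gt0; apply: leq_trans hk.
pose j0 := Ordinal h0.
split=> [[x ex]|[l [y ly]]]; last first.
  (* The phase sits in the single coordinate [j0]: it enters the fiber product once, and its k-th
     power is 1. *)
  pose x (p : V * 'I_(k./2)) :=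
    (if p.2 == j0 then phase R (l p.1) else 1) * (k./2).-root (y p.1).
  exists x; apply: (gen_power_eigenpair_of_support ly) => [v j|v].
    rewrite /x /= exprMn -(exprn_half2 (_.-root _)) rootCK //.
    by case: ifP; rewrite ?phase_expr ?expr1n mul1r.
  rewrite /fiber_prod big_split /= prodr_const card_ord rootCK //; congr (_ * _).
  rewrite (bigD1 j0) //= big1 ?mulr1 // => j /negbTE -> //.
have [[v vd]|nd] := pselect (exists v, (vdegree G v)%:R == lambda).
  exists (fun=> Ordinal k0), (fun u => (u == v)%:R).
  by rewrite -(eqP vd); apply: support_eigenvector_degree.
have {}nd v : (vdegree G v)%:R != lambda by apply/negP => vd; apply: nd; exists v.
have xc := gen_power_fiber_const ex nd.
pose y v := x (v, j0) ^+ k./2.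
have /choice[l lE] v : exists l : 'I_k, fiber_prod x v = phase R l * y v.
  have [xv|xv] := eqVneq (x (v, j0)) 0.
    (* Both sides are zero here, so the trivial phase is chosen. *)
    exists (Ordinal k0); rewrite /fiber_prod (bigD1 j0) //= /y xv mul0r.
    by rewrite expr0n gtn_eqF // mulr0.
  have yv : y v != 0 by rewrite expf_neq0.
  have [|l zl] := @phase_surj R k (fiber_prod x v / y v) k0; last first.
    by exists l; rewrite -zl divfK.
  (* With $h=k/2$, constancy on the fiber gives $p_v^k=\prod_j x_{(v,j)}^k=x_{(v,0)}^{kh}=y_v^k$, so
     $p_v/y_v$ is a k-th root of unity. *)
  rewrite expr_div_n /fiber_prod -prodrXl.
  under eq_bigr do rewrite (xc v _ j0).
  by rewrite prodr_const card_ord /y exprAC divff // !expf_neq0.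
exists l, y; apply: (gen_power_support_of_eigenpair ex nd _ lE) => v j.
by rewrite /y exprn_half2 (xc v j0 j).
Qed.

Lemma Hspectrum_gen_powerP lambda : Hspectrum L lambda <->
  exists y : V -> R[i], support_eigenvector G (fun=> 1) lambda y.
Proof.
have k0 : (0 < k)%N by apply: leq_trans hk.
have h0 : (0 < k./2)%N by rewrite half_gt0; apply: leq_trans hk.
pose j0 := Ordinal h0.
have fiberC x v : fiber_prod (fun p : V * 'I_(k./2) => (x p : R)%:C) v =
    (fiber_prod x v)%:C by rewrite /fiber_prod rmorph_prod.
split=> [[x ex]|[y0 /support_eigenvector_real[y ly]]]; last first.
  (* The nonnegative real root of order $k/2$ of $|y_v|$. The sign of $y_v$ then goes into one
     coordinate, and disappears in the k-th power because [k] is even. *)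
  pose b v := `|y v| `^ (k./2%:R^-1).
  have bE v : b v ^+ k./2 = `|y v|.
    rewrite -powR_mulrn ?powR_ge0 // -powRrM mulVf ?powRr1 //.
    by rewrite pnatr_eq0 -lt0n.
  pose x (p : V * 'I_(k./2)) := (if p.2 == j0 then Num.sg (y p.1) else 1) * b p.1.
  exists x; apply: (gen_power_eigenpair_of_support ly) => [v j|v].
    rewrite -!rmorphXn /x /= exprMn -(exprn_half2 (b v)) bE real_normK ?num_real //.
    case: ifP; rewrite ?expr1n ?mul1r // => _.
    have [->|yv] := eqVneq (y v) 0; first by rewrite expr0n mulr0.
    by rewrite -exprn2_half sqr_sg yv expr1n mul1r.
  rewrite fiberC mul1r /fiber_prod big_split /= prodr_const card_ord bE.
  rewrite (bigD1 j0) //= big1 ?mulr1 => [|j /negbTE -> //].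
  by rewrite -numEsg.
have [[v vd]|nd] := pselect (exists v, (vdegree G v)%:R == lambda).
  exists (fun u => (u == v)%:R).
  by rewrite -(eqP vd); apply: support_eigenvector_degree.
have {}nd v : (vdegree G v)%:R != lambda by apply/negP => vd; apply: nd; exists v.
have xc := gen_power_fiber_const ex nd.
exists (fun v => (fiber_prod x v)%:C).
apply: (gen_power_support_of_eigenpair ex nd) => [v j|v]; last by rewrite fiberC mul1r.
rewrite -!rmorphXn; congr (_%:C); rewrite /fiber_prod -prodrXl.
(* Equal k-th powers of reals give equal squares, since raising to the power $k/2$ is injective on
   nonnegative reals; hence $p_v^2=x_{(v,j)}^k$. *)
have x2 i : x (v, i) ^+ 2 = x (v, j) ^+ 2.
  apply: (pexpIrn h0); rewrite ?nnegrE ?sqr_ge0 // !exprn2_half.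
  by have := xc v i j; rewrite -!rmorphXn => /complexI.
under eq_bigr do rewrite x2.
by rewrite prodr_const card_ord exprn2_half.
Qed.
End SpectraGenPower.

(** * The two set equalities *)

Theorem theorem2p8 (R : realType) (k : nat) (V : finType) (G : hypergraph V)
    (hk : (4 <= k)%N) (hk_even : ~~ odd k) (hG : simple_graph G) :
  spectrum (laplacian_tensor R k (gen_power k G)) =
    \bigcup_(U in [set U : {set V} | lconnected (modified_induced G U)])
      \bigcup_(l in [set: {v : V | v \in U} -> 'I_k])
        mx_spectrum (twisted_laplacian R (modified_induced G U) l)
  /\
  Hspectrum (laplacian_tensor R k (gen_power k G)) =
    \bigcup_(U in [set U : {set V} | lconnected (modified_induced G U)])
      mx_spectrum (laplacian_mx R[i] (modified_induced G U)).
Proof.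
have k0 : (0 < k)%N by apply: leq_trans hk.
split; apply/seteqP; split=> lambda.
- move=> /spectrum_gen_powerP -/(_ hk hk_even hG)[l [y ly]].
  have [U cU eU] := support_eigenvector_modified ly.
  by exists U => //; exists (fun s => l (val s)).
- move=> [U _ [l _ el]]; apply/spectrum_gen_powerP => //.
  (* The phases are extended by 1 outside [U]. *)
  pose l' v := if insub v is Some s then l s else Ordinal k0.
  have E : (fun s : {v | v \in U} => l' (val s)) = l.
    by apply/funext => s; rewrite /l' valK.
  by exists l'; apply: (@support_eigenvector_of_modified _ _ _ _ U); rewrite E.
- move=> /Hspectrum_gen_powerP -/(_ hk hk_even hG)[y ly].
  have [|U cU] := @support_eigenvector_modified R k V G (fun=> Ordinal k0) lambda y.
    by rewrite phase0.
  by rewrite twisted_laplacian0 => eU; exists U.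
- move=> [U _ eU]; apply/Hspectrum_gen_powerP => //.
  have := @support_eigenvector_of_modified R k V G U (fun=> Ordinal k0) lambda.
  by rewrite twisted_laplacian0 phase0; apply.
Qed.
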